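(* For every integer $n\geqslant 0$, $$\sum_{k=0}^{\lfloor n/2\rfloor}\ \sum_{q=0}^{k}\binom{n-k}{q}=F_{n+3}-2^{\lfloor (n+1)/2\rfloor}.$$
   Context: $(F_n)_{n\geqslant 0}$ denotes the Fibonacci numbers: $F_0=0$, $F_1=1$, and $F_{n+2}=F_{n+1}+F_n$ for all $n\geqslant 0$. *)

(* Defs.v *)
From mathcomp Require Import all_boot all_order all_algebra.

Set Implicit Arguments.
Unset Strict Implicit.
Unset Printing Implicit Defensive.

Fixpoint fib (n : nat) : nat :=
  match n with
  | 0 => 0
  | 1 => 1
  | (m.+1 as p).+1 => fib p + fib m
  end.

(* Main.v *)
Require Import Defs.
From mathcomp Require Import all_boot all_order all_algebra.
From mathcomp Require Import zify.

Import GRing.Theory.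
Local Open Scope ring_scope.

(** Write S(m, k) for the sum of the binomials C(m, q) over q <= k.  The idea
    is to let k run up to n instead of n/2.  The completed sum
    T(n) = S(n, 0) + S(n-1, 1) + ... + S(0, n) has no parity in its range, and
    Pascal's rule S(m+1, k+1) = S(m, k+1) + S(m, k) applied termwise gives
    T(n+2) = T(n+1) + T(n) + 1; hence T(n) + 1 is F_{n+3}
    ([sum_diag_bin_prefix]).  In the terms added, k > n/2, so k >= n - k and
    S(n-k, k) is a whole row sum 2^(n-k); these powers run through
    1, 2, 4, ... and, with the extra 1, make up the power of two of the theorem
    ([sum_diag_bin_prefix_tail]). *)

Definition bin_prefix (m k : nat) : nat := (\sum_(0 <= q < k.+1) 'C(m, q))%N.

Lemma bin_prefix0 m : bin_prefix m 0 = 1%N.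
Proof. by rewrite /bin_prefix big_nat1 bin0. Qed.

Lemma bin_prefixS m k :
  bin_prefix m.+1 k.+1 = (bin_prefix m k.+1 + bin_prefix m k)%N.
Proof.
rewrite /bin_prefix big_nat_recl // [in RHS]big_nat_recl //.
under eq_bigr do rewrite binS.
by rewrite big_split /= !bin0 addnA.
Qed.

Lemma bin_prefix_full m k : (m <= k)%N -> bin_prefix m k = (2 ^ m)%N.
Proof.
move=> le_mk; rewrite -[2%N]/(1 + 1)%N expnDn /bin_prefix.
rewrite -(big_mkord xpredT (fun q => 'C(m, q) * (1 ^ (m - q) * 1 ^ q))%N).
rewrite (big_cat_nat _ (n := m.+1)) //= [X in (_ + X)%N](_ : _ = 0%N).
  by rewrite addn0; apply: eq_bigr => q _; rewrite !exp1n !muln1.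
rewrite big_nat_cond big1 // => q /andP[/andP[lt_mq _] _].
by rewrite bin_small.
Qed.

(** Pascal's rule shifts the diagonal n + 2 onto the diagonals n + 1 and n: the
    terms (n-j, j+1) together with the corner S(n+2, 0) = 1 = S(n+1, 0) make up
    the first, the terms (n-j, j) the second.  The corner S(0, n+2) = 1, to which the rule
    does not apply, is the 1 that makes the Fibonacci recurrence hold for the
    sum plus one. *)
Lemma sum_diag_bin_prefix n :
  (\sum_(0 <= k < n.+1) bin_prefix (n - k) k).+1 = fib (n + 3).
Proof.
pose T n := (\sum_(0 <= k < n.+1) bin_prefix (n - k) k)%N.
have TSS p : T p.+2 = (T p.+1 + T p).+1.
  rewrite /T big_nat_recl // big_nat_recr //= !subSS subnn bin_prefix0.
  rewrite [X in (_ = (X + _).+1)%N]big_nat_recl // bin_prefix0.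
  under eq_big_nat => k le_kp do rewrite subSS subSn // bin_prefixS.
  rewrite big_split /=.
  under [in RHS]eq_bigr do rewrite subSS.
  by rewrite (@bin_prefix_full 0) // expn0; lia.
rewrite -[LHS]/((T n).+1).
suff [] : (T n).+1 = fib (n + 3) /\ (T n.+1).+1 = fib (n.+1 + 3) by [].
elim: n => [|n [IH0 IH1]].
  by rewrite /T !big_nat_recr //= !big_geq //= !bin_prefix0 bin_prefix_full.
split=> //; rewrite TSS.
have -> : fib (n.+2 + 3) = (fib (n.+1 + 3) + fib (n + 3))%N by rewrite !addnS.
by rewrite -IH0 -IH1 addSn addnS.
Qed.

(** Beyond the middle of the diagonal every prefix sum is a whole row, and
    the rows left have indices 0, ..., ceil(n/2) - 1. *)
Lemma sum_diag_bin_prefix_tail n :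
  (\sum_((n %/ 2).+1 <= k < n.+1) bin_prefix (n - k) k).+1
  = (2 ^ ((n + 1) %/ 2))%N.
Proof.
rewrite big_nat_rev -{1}[(n %/ 2).+1]add0n big_addn /=.
have -> : (n.+1 - (n %/ 2).+1 = (n + 1) %/ 2)%N by lia.
rewrite -[RHS]prednK ?expn_gt0 // predn_exp mul1n big_mkord.
congr _.+1; apply: eq_bigr => i _.
rewrite bin_prefix_full; last by have := ltn_ord i; lia.
by congr expn; have := ltn_ord i; lia.
Qed.

Theorem theorem3 (n : nat) :
  (\sum_(0 <= k < (n %/ 2).+1) \sum_(0 <= q < k.+1) 'C(n - k, q))%N%:Z
  = (fib (n + 3)%N)%:Z - 2%:Z ^+ ((n + 1) %/ 2)%N.
Proof.
rewrite -sum_diag_bin_prefix.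
rewrite [in RHS](big_cat_nat _ (n := (n %/ 2).+1)) //= ?ltnS ?leq_div //.
by rewrite -addnS sum_diag_bin_prefix_tail PoszD -!natz natrX addrK.
Qed.
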